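(* Consider the sender-receiver game $\Gamma$ with data $(K,p,M,X,(U^k)_{k\in K},(V^k)_{k\in K},(u_0^k)_{k\in K})$ described in the context. Assume that $K=\{1,2,3\}$ and that the participation structure is $\mathcal{T}^*=\{\{1,2\},\{1,3\},\{2,3\}\}$. Then $\Gamma$ has a mediated equilibrium.
   Context: Data of the game $\Gamma$. $K$ is a nonempty finite set of types; $p\in\Delta(K)$ is a prior probability with $p^k>0$ for every $k\in K$; $M$ is a finite set of messages with $|M|\ge|K|$; $X$ is a compact (topological) space of decisions; for every $k\in K$, $U^k:X\to\mathbb{R}$ (sender, player 1) and $V^k:X\to\mathbb{R}$ (receiver, player 2) are continuous utility functions and $u_0^k\in\mathbb{R}$ is the sender's outside option. It is assumed that for every $k\in K$ there exists $x\in X$ with $U^k(x)\ge u_0^k$. Interpretation: a type $k$ is drawn from $p$ and told to the sender; after communication the receiver proposes $x\in X$; if the sender accepts, payoffs are $U^k(x),V^k(x)$; if he rejects (exit), he gets $u_0^k$ and the receiver gets $-\infty$. The sender of type $k$ accepts $x$ if and only if $U^k(x)\ge u_0^k$. For $L\subseteq K$ let $X(L)=\{x\in X: U^k(x)\ge u_0^k \ \forall k\in L\}$. Let $\mathcal{T}=\{L\subseteq K: L\neq\emptyset,\ X(L)\ne\emptyset\}$. The participation structure $\mathcal{T}^*$ of $\Gamma$ is the set of maximal elements of $\mathcal{T}$ for set inclusion. Mediated equilibrium. Instead of sending a message directly to the receiver, the sender reports a type in $K$ to a mediator, who then selects a decision in $X$ and recommends it to the receiver. A mediator is a map $\mu$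 assigning to every $k\in K$ a finitely supported probability distribution $\mu(\cdot\mid k)$ on $X$. For $x$ with $P_\mu(x)=\sum_k p^k\mu(x\mid k)>0$, let $p_x^k=p^k\mu(x\mid k)/P_\mu(x)$ and $p_x=(p_x^k)_{k\in K}$. A mediated equilibrium is a mediator $\mu$ such that truthful reporting by the sender, obedience by the receiver, and acceptance by the sender of type $k$ of exactly the proposals $x$ with $U^k(x)\ge u_0^k$, form an equilibrium without exit, namely: (1) for all $k,j\in K$, $\sum_x\mu(x\mid k)U^k(x)\ge\sum_x\mu(x\mid j)\max\{U^k(x),u_0^k\}$; (2) for every $x$ with $P_\mu(x)>0$, $x\in X(\mathrm{supp}\,p_x)$ and $x$ maximizes $\sum_k p_x^kV^k(y)$ over $y\in X(\mathrm{supp}\,p_x)$. *)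

(* Defs.v *)
From HB Require Import structures.
From mathcomp Require Import all_boot all_order all_algebra.
From mathcomp Require Import all_classical all_reals all_analysis.

Set Implicit Arguments.
Unset Strict Implicit.
Unset Printing Implicit Defensive.

Import Order.TTheory GRing.Theory Num.Theory.
Import numFieldNormedType.Exports.

Local Open Scope ring_scope.

(* [K]: types, [M]: messages, [X]: decisions.  [K] is nonempty because
   [prior_sum1] would otherwise fail. *)
Record game (R : realType) (K M : finType) (X : topologicalType) := Game {
  prior : K -> R;
  prior_gt0 : forall k, 0 < prior k;
  prior_sum1 : \sum_k prior k = 1;
  card_messages : (#|K| <= #|M|)%N;
  decisions_compact : compact [set: X]%classic;
  sender_utility : K -> X -> R;
  receiver_utility : K -> X -> R;
  sender_utility_continuous : forall k, continuous (sender_utility k);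
  receiver_utility_continuous : forall k, continuous (receiver_utility k);
  outside_option : K -> R;
  outside_option_le : forall k, exists x, outside_option k <= sender_utility k x
}.

(* X(L): the decisions that every type in [L] accepts. *)
Definition acceptable (R : realType) (K M : finType) (X : topologicalType)
    (G : game R K M X) (L : {set K}) : set X :=
  [set x | forall k, k \in L -> outside_option G k <= sender_utility G k x]%classic.

Definition jointly_participating (R : realType) (K M : finType)
    (X : topologicalType) (G : game R K M X) : {set {set K}} :=
  [set L : {set K} | (L != finset.set0) && `[< (acceptable G L !=set0)%classic >]]%SET.

Definition participation_structure (R : realType) (K M : finType)
    (X : topologicalType) (G : game R K M X) : {set {set K}} :=
  [set L : {set K} | maxset [in jointly_participating G] L]%SET.

(* Sums [\sum_(x \in [set: X]) F x] range over the support of [F] and are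
   meaningful when that support is finite, as it is for every [F] that is a
   multiple of a [finite_distribution]. *)
Record finite_distribution (R : realType) (X : choiceType) := FiniteDistribution {
  mass :> X -> R;
  mass_ge0 : forall x, 0 <= mass x;
  mass_finite : finite_set [set x | mass x != 0]%classic;
  mass_sum1 : \sum_(x \in [set: X]%classic) mass x = 1
}.

(* [mu k x] is mu(x | k). *)
Definition mediator (R : realType) (K : finType) (X : choiceType) :=
  K -> finite_distribution R X.

Definition recommendation_prob (R : realType) (K M : finType)
    (X : topologicalType) (G : game R K M X) (mu : mediator R K X) (x : X) : R :=
  \sum_k prior G k * mu k x.

(* Only meaningful when [0 < recommendation_prob G mu x]. *)
Definition posterior (R : realType) (K M : finType) (X : topologicalType)
    (G : game R K M X) (mu : mediator R K X) (x : X) (k : K) : R :=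
  prior G k * mu k x / recommendation_prob G mu x.

Definition posterior_support (R : realType) (K M : finType)
    (X : topologicalType) (G : game R K M X) (mu : mediator R K X) (x : X) :
    {set K} :=
  [set k | posterior G mu x k != 0]%SET.

(* A type that misreports may still exit after the proposal, hence the max. *)
Definition truthful (R : realType) (K M : finType) (X : topologicalType)
    (G : game R K M X) (mu : mediator R K X) : Prop :=
  forall k j : K,
    \sum_(x \in [set: X]%classic)
        mu j x * Num.max (sender_utility G k x) (outside_option G k)
    <= \sum_(x \in [set: X]%classic) mu k x * sender_utility G k x.

(* Exit costs the receiver an infinite amount, so he only compares decisions
   accepted by all the types he considers possible. *)
Definition obedient (R : realType) (K M : finType) (X : topologicalType)
    (G : game R K M X) (mu : mediator R K X) : Prop :=
  forall x : X, 0 < recommendation_prob G mu x ->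
    acceptable G (posterior_support G mu x) x /\
    forall y : X, acceptable G (posterior_support G mu x) y ->
      \sum_k posterior G mu x k * receiver_utility G k y
      <= \sum_k posterior G mu x k * receiver_utility G k x.

Definition mediated_equilibrium (R : realType) (K M : finType)
    (X : topologicalType) (G : game R K M X) (mu : mediator R K X) : Prop :=
  truthful G mu /\ obedient G mu.

(* The three elements 1, 2, 3 of K. *)
Definition type1 : 'I_3 := @Ordinal 3 0 isT.
Definition type2 : 'I_3 := @Ordinal 3 1 isT.
Definition type3 : 'I_3 := @Ordinal 3 2 isT.

(* Main.v *)
Require Import Defs.
From mathcomp Require Import all_boot all_order all_algebra.
From mathcomp Require Import all_classical all_reals all_analysis.
From mathcomp Require Import ring.

(** The participation structure says that no decision is accepted by all three
    types, but every pair of types has a jointly acceptable one.  More generally,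
    suppose that no decision is accepted by all the types while, for each type
    [k], some decision is accepted by all the others.  Let [d k] be one that the
    receiver likes best, for the prior weights, among those accepted by every
    type but [k]; type [k] must then reject it.  On report [k], the mediator
    draws [j <> k] uniformly and recommends [d j].

    Obedience: as [d] is injective and every type other than [j] gets [d j] with
    the same probability, [d j] only reveals that the type is not [j]; it is
    optimal for that posterior by construction ([exclusion_obedient]).

    Truthfulness: the lotteries on reports [k] and [j] differ only in that the
    former may yield [d j] where the latter yields [d k].  Type [k] accepts
    [d j] and exits at [d k], so lying replaces an acceptable decision by the
    outside option ([exclusion_truthful]). *)

Set Implicit Arguments.
Unset Strict Implicit.
Unset Printing Implicit Defensive.

Import Order.TTheory GRing.Theory Num.Theory.
Import numFieldNormedType.Exports.

Local Open Scope ring_scope.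

(** * Uniform lotteries over finitely many decisions *)

Section UniformLottery.
Variables (R : realType) (K : finType) (X : choiceType) (d : K -> X).
Variables (A : {set K}) (A_gt0 : (0 < #|A|)%N).

(** The law of [d i] for [i] uniform in [A]: a decision that [d] takes several
    times accumulates the corresponding masses. *)
Definition uniform_mass (x : X) : R :=
  #|A|%:R^-1 * \sum_(i in A) (x == d i)%:R.

Lemma uniform_mass_ge0 x : 0 <= uniform_mass x.
Proof. by rewrite mulr_ge0 ?invr_ge0 ?ler0n // sumr_ge0. Qed.

Lemma uniform_mass_out x : (forall i, x != d i) -> uniform_mass x = 0.
Proof.
move=> xd; rewrite /uniform_mass big1 ?mulr0 // => i _.
by rewrite (negbTE (xd i)).
Qed.

Lemma uniform_mass_finite : finite_set [set x | uniform_mass x != 0]%classic.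
Proof.
apply: (@sub_finite_set _ _ [set d i | i in [set: K]]%classic).
  move=> x /=; apply: contra_neqP => xd.
  by apply: uniform_mass_out => i; apply/eqP => xE; apply: xd; exists i.
exact/finite_image/finite_finset.
Qed.

Lemma fsum_dirac (a : X) (f : X -> R) :
  \sum_(x \in [set: X]%classic) (x == a)%:R * f x = f a.
Proof.
rewrite -(@fsbig_widen _ _ _ _ [set a]%classic) ?fsbig_set1 ?eqxx ?mul1r //.
by move=> x [_ /= /eqP/negbTE ->]; rewrite mul0r.
Qed.

Lemma fsum_uniform_mass (f : X -> R) :
  \sum_(x \in [set: X]%classic) uniform_mass x * f x =
  #|A|%:R^-1 * \sum_(i in A) f (d i).
Proof.
pose D := [set d i | i in [set: K]]%classic.
have finD : finite_set D by exact/finite_image/finite_finset.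
have outD x i : (~ D x) -> (x == d i) = false.
  by move=> nDx; apply/eqP => xE; apply: nDx; exists i.
rewrite -(@fsbig_widen _ _ _ _ D) //; last first.
  move=> x [_ nDx] /=; rewrite uniform_mass_out ?mul0r // => i.
  by rewrite outD.
rewrite fsbig_finite //.
under eq_bigr do rewrite -mulrA mulr_suml.
rewrite -mulr_sumr exchange_big /=; congr (_ * _).
apply: eq_bigr => i _; rewrite -fsbig_finite // -[RHS]fsum_dirac.
by apply: fsbig_widen => // x [_ nDx] /=; rewrite outD ?mul0r.
Qed.

Lemma uniform_mass_inj i :
  injective d -> uniform_mass (d i) = #|A|%:R^-1 * (i \in A)%:R.
Proof.
move=> d_inj; congr (_ * _); have [iA|niA] := boolP (i \in A).
  rewrite (bigD1 i) //= eqxx big1 ?addr0 // => j /andP[_ jNi].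
  by rewrite (inj_eq d_inj) eq_sym (negbTE jNi).
rewrite big1 // => j jA; rewrite (inj_eq d_inj).
by case: eqVneq jA => // <-; rewrite (negbTE niA).
Qed.

Lemma uniform_mass_sum1 : \sum_(x \in [set: X]%classic) uniform_mass x = 1.
Proof.
transitivity (\sum_(x \in [set: X]%classic) uniform_mass x * 1).
  by apply: eq_fsbigr => x _; rewrite mulr1.
by rewrite fsum_uniform_mass sumr_const mulVf // pnatr_eq0 -lt0n.
Qed.

Definition uniform_lottery : finite_distribution R X :=
  FiniteDistribution uniform_mass_ge0 uniform_mass_finite uniform_mass_sum1.

End UniformLottery.

(** * The mediator that excludes one type at random *)

Section ExclusionMediator.
Variables (R : realType) (K M : finType) (X : topologicalType).
Variable G : game R K M X.

Local Notation U := (sender_utility G).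
Local Notation V := (receiver_utility G).
Local Notation u0 := (outside_option G).

Lemma acceptable_compact (L : {set K}) : compact (acceptable G L).
Proof.
apply: subclosed_compact (decisions_compact G) _ => //.
have -> : acceptable G L =
    (\bigcap_(k in [set` L]) (U k @^-1` [set r | u0 k <= r]))%classic.
  by [].
apply: closed_bigI => k _.
apply: closed_comp; last exact: closed_ge.
by move=> x _; exact: sender_utility_continuous.
Qed.

Lemma receiver_best_reply (L : {set K}) (w : K -> R) :
  (acceptable G L !=set0)%classic ->
  exists2 x, acceptable G L x & forall y, acceptable G L y ->
    \sum_(k in L) w k * V k y <= \sum_(k in L) w k * V k x.
Proof.
move=> L0.
have cont : continuous (fun y => \sum_(k in L) w k * V k y).
  move=> y; apply: cvg_big => [|k _]; first exact: add_continuous.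
  apply: cvgM; first exact: cvg_cst.
  exact: receiver_utility_continuous.
have [x xL xmax] := compact_EVT_max L0 (@acceptable_compact L)
  (continuous_subspaceT cont).
exists x; first by rewrite inE in xL.
by move=> y yL; apply: xmax; rewrite inE.
Qed.

Hypothesis K_gt1 : (1 < #|K|)%N.

Lemma others_gt0 (k : K) : (0 < #|[set~ k]%SET|)%N.
Proof. by rewrite cardsC1 -subn1 subn_gt0. Qed.

Variable d : K -> X.
Hypothesis d_accepted : forall j k, k != j -> u0 k <= U k (d j).
Hypothesis d_rejected : forall k, U k (d k) < u0 k.

Definition exclusion_mediator : mediator R K X :=
  fun k => uniform_lottery R d (others_gt0 k).

Local Notation c := ((#|K|.-1)%:R^-1 : R).

(** Type [k] tells [d k], which it rejects, from all the other decisions, which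
    it accepts. *)
Lemma decision_inj : injective d.
Proof.
move=> i j dE; apply/eqP/negPn/negP => iNj.
by have := d_rejected i; rewrite dE ltNge d_accepted.
Qed.

Lemma others_inv_gt0 : 0 < c.
Proof. by rewrite invr_gt0 ltr0n -subn1 subn_gt0. Qed.

Lemma exclusion_mass k j : exclusion_mediator k (d j) = c * (k != j)%:R.
Proof.
rewrite /= uniform_mass_inj ?cardsC1; last exact: decision_inj.
by rewrite !inE eq_sym.
Qed.

Lemma exclusion_sum k (f : X -> R) :
  \sum_(x \in [set: X]%classic) exclusion_mediator k x * f x =
  c * \sum_(i | i != k) f (d i).
Proof.
rewrite fsum_uniform_mass cardsC1; congr (_ * _).
by apply: eq_bigl => i; rewrite !inE.
Qed.

(** The lotteries on the true report [k] and on the lie [j] share every [d i]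
    with [i] other than [j] and [k]; what remains to compare is [d j], which
    [k] accepts, with [d k], at which [k] exits. *)
Lemma exclusion_truthful : truthful G exclusion_mediator.
Proof.
move=> k j; rewrite !exclusion_sum ler_pM2l ?others_inv_gt0 //.
have [<-|kNj] := eqVneq k j.
  by apply: ler_sum => i ik; rewrite max_l // d_accepted // eq_sym.
rewrite (bigD1 k) //= [leRHS](bigD1 j) 1?eq_sym //=.
rewrite max_r ?(ltW (d_rejected k)) // lerD ?d_accepted //.
under eq_bigl do rewrite andbC.
by apply: ler_sum => i /andP[ik _]; rewrite max_l // d_accepted // eq_sym.
Qed.

Hypothesis d_optimal : forall j y, acceptable G [set~ j]%SET y ->
  \sum_(k in [set~ j]%SET) prior G k * V k y
  <= \sum_(k in [set~ j]%SET) prior G k * V k (d j).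

(** All types but [j] receive [d j] with the same probability, so the posterior
    at [d j] is the prior conditioned on the type not being [j]. *)
Lemma exclusion_obedient : obedient G exclusion_mediator.
Proof.
move=> x; set P := recommendation_prob _ _ _ => P_gt0.
have [j xE] : exists j, x = d j.
  apply: contrapT => xNd; move: P_gt0; rewrite /P /recommendation_prob big1.
    by rewrite ltxx.
  move=> k _; rewrite /= uniform_mass_out ?mulr0 // => i.
  by apply/eqP => xE; apply: xNd; exists i.
have postE k : posterior G exclusion_mediator x k =
    c / P * (prior G k * (k != j)%:R).
  by rewrite /posterior -/P {1}xE exclusion_mass; ring.
have cP_gt0 : 0 < c / P by rewrite divr_gt0 ?others_inv_gt0.
have suppE : posterior_support G exclusion_mediator x = [set~ j]%SET.
  apply/setP => k; rewrite !inE postE mulf_eq0 gt_eqF //=.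
  by rewrite mulf_eq0 gt_eqF ?prior_gt0 //= pnatr_eq0 eqb0 negbK.
have payoffE y : \sum_k posterior G exclusion_mediator x k * V k y =
    c / P * \sum_(k in [set~ j]%SET) prior G k * V k y.
  rewrite mulr_sumr [RHS]big_mkcond /=; apply: eq_bigr => k _.
  rewrite postE !inE; case: (k != j) => /=; first by rewrite mulr1 mulrA.
  by rewrite !mulr0 mul0r.
rewrite suppE xE; split=> [k|y yL]; first by rewrite !inE => /d_accepted.
by rewrite -xE !payoffE xE ler_pM2l // d_optimal.
Qed.

End ExclusionMediator.

Theorem exclusion_equilibrium (R : realType) (K M : finType)
    (X : topologicalType) (G : game R K M X) :
  (1 < #|K|)%N ->
  (forall k, (acceptable G [set~ k]%SET !=set0)%classic) ->
  ~ (acceptable G [set: K]%SET !=set0)%classic ->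
  exists mu : mediator R K X, mediated_equilibrium G mu.
Proof.
move=> K_gt1 others all0.
have /choice[d dP] : forall j, exists x, acceptable G [set~ j]%SET x /\
    forall y, acceptable G [set~ j]%SET y ->
      \sum_(k in [set~ j]%SET) prior G k * receiver_utility G k y
      <= \sum_(k in [set~ j]%SET) prior G k * receiver_utility G k x.
  by move=> j; have [x xL xmax] := receiver_best_reply (prior G) (others j);
    exists x.
have d_acc j k : k != j -> outside_option G k <= sender_utility G k (d j).
  by move=> kNj; apply: (dP j).1; rewrite !inE.
have d_rej k : sender_utility G k (d k) < outside_option G k.
  rewrite ltNge; apply/negP => dk; apply: all0; exists (d k) => i _.
  by have [->|/d_acc] := eqVneq i k.
exists (exclusion_mediator R K_gt1 d); split.
  exact: exclusion_truthful.
by apply: exclusion_obedient => // j; exact: (dP j).2.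
Qed.

(** * Three types *)

Theorem mainTheorem6 (R : realType) (M : finType) (X : topologicalType)
    (G : game R 'I_3 M X) :
  participation_structure G =
    [set [set type1; type2]; [set type1; type3]; [set type2; type3]]%SET ->
  exists mu : mediator R 'I_3 X, mediated_equilibrium G mu.
Proof.
move=> structE; apply: exclusion_equilibrium; first by rewrite card_ord.
  move=> k.
  have : [set~ k]%SET \in participation_structure G.
    have setCE : [set~ type3]%SET = [set type1; type2]%SET /\
        [set~ type2]%SET = [set type1; type3]%SET /\
        [set~ type1]%SET = [set type2; type3]%SET.
      by repeat split; apply/setP => -[[|[|[|]]] ?] //; rewrite !inE.
    have [E3 [E2 E1]] := setCE.
    have : [|| k == type1, k == type2 | k == type3].
      by case: k => -[|[|[|]]].
    by rewrite structE => /or3P[] /eqP ->; rewrite ?E1 ?E2 ?E3 !inE eqxx ?orbT.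
  by rewrite inE => /maxsetp; rewrite !inE => /andP[_ /asboolP].
move=> all0.
(* A decision accepted by all the types would make the full set, which is not a
   pair, a maximal element. *)
have : [set: 'I_3]%SET \in participation_structure G.
  rewrite inE; apply/maxsetP; split; last first.
    by move=> B _; rewrite finset.subTset => /eqP.
  rewrite !inE; apply/andP; split; last exact/asboolP.
  by apply/set0Pn; exists type1; rewrite inE.
rewrite structE !inE => /orP[/orP[]|] /eqP/setP E.
- by have := E type3; rewrite !inE.
- by have := E type2; rewrite !inE.
- by have := E type1; rewrite !inE.
Qed.
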